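(* Let $f$ be a consensus function on the $n$-cube $Q_n$. Then $f = Cen$ if and only if $f$ satisfies the Translation axiom (T) and, for every profile $\pi$, $$\mathbf{0}\in f(\pi)\ \text{ if and only if }\ \Vert\pi\Vert\le\Vert\pi\oplus u\Vert \text{ for all } u\in X.$$
   Context: $Q_n=(X,E)$ is the $n$-dimensional hypercube graph with vertex set $X=\{0,1\}^n$ and distance $d(u,v)=\sum_{i=1}^n|u_i-v_i|$ (Hamming distance). A profile is a finite sequence $\pi=(x_1,\dots,x_k)$ of vertices of $X$ of any length $k\ge 1$; $X^*=\bigcup_{k\ge1}X^k$ is the set of all profiles. A consensus function on $Q_n$ is a map $f:X^*\to 2^X\setminus\{\emptyset\}$. For $u,v\in X$, $u\oplus v$ denotes coordinatewise addition modulo 2, and $\pi\oplus u=(x_1\oplus u,\dots,x_k\oplus u)$. $\mathbf{0}=(0,\dots,0)$. For $u \in X$, $\Vert u\Vert=d(\mathbf 0,u)$ is the number of ones in $u$, and for a profile $\pi=(x_1,\dots,x_k)$, $\Vert\pi\Vert=\max\{\Vert x_1\Vert,\dots,\Vert x_k\Vert\}$. The center function $Cen$ is defined by $Cen(\pi)=\{x\in X: e(x,\pi)\text{ is minimum}\}$, where $e(x,\pi)=\max\{d(x,x_1),\dots,d(x,x_k)\}$ and the minimum is over all $x\in X$. Translation (T): for every profile $\pi$ and all vertices $u,v\in X$, $u\in f(\pi)$ implies $u\oplus v\in f(\pi\oplus v)$. *)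

(* Defs.v *)
From mathcomp Require Import all_boot all_order all_algebra.

Set Implicit Arguments.
Unset Strict Implicit.
Unset Printing Implicit Defensive.

Definition cube (n : nat) := {ffun 'I_n -> bool}.

Definition zero n : cube n := [ffun=> false].

(* Coordinatewise addition modulo 2 on {0,1} = bool. *)
Definition xor n (u v : cube n) : cube n := [ffun i => u i (+) v i].

(* In [`|a - b|%N] the subtraction is the integer one, not the truncated one. *)
Definition dist n (u v : cube n) : nat := \sum_(i < n) `|u i - v i|%N.

(* X^* is the disjoint union of the X^k, k >= 1; the tag is k.-1. *)
Definition profile (n : nat) := {k : nat & k.+1.-tuple (cube n)}.

Definition shift n (pi : profile n) (u : cube n) : profile n :=
  Tagged (fun k => k.+1.-tuple (cube n)) [tuple of [seq xor x u | x <- tagged pi]].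

Definition norm n (u : cube n) : nat := dist (zero n) u.

(* \max has default value 0 on nat, which is harmless for a nonempty profile. *)
Definition pnorm n (pi : profile n) : nat := \max_(x <- tagged pi) norm x.

Definition ecc n (x : cube n) (pi : profile n) : nat :=
  \max_(y <- tagged pi) dist x y.

Definition Cen n (pi : profile n) : {set cube n} :=
  [set x | [forall y, ecc x pi <= ecc y pi]].

Definition consensus n (f : profile n -> {set cube n}) : Prop :=
  forall pi, f pi != set0.

Definition translation n (f : profile n -> {set cube n}) : Prop :=
  forall (pi : profile n) (u v : cube n),
    u \in f pi -> xor u v \in f (shift pi v).

Lemma Cen_consensus n : consensus (@Cen n).
Proof.
move=> pi; apply/set0Pn.
case: (arg_minnP (fun x => ecc x pi) (erefl : xpredT (zero n))) => x _ xmin.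
by exists x; rewrite inE; apply/forallP => y; apply: xmin.
Qed.

(* Main.v *)
Require Import Defs.
From mathcomp Require Import all_boot all_order all_algebra.

(** A translation-invariant [f] is determined by the set of profiles whose
    value contains [zero n]: since [xor] by [u] is an involution,
    [u] is in [f pi] exactly when [zero n] is in [f (shift pi u)]
    ([translation_mem]).  Hence it is enough that [Cen] itself satisfies the two
    conditions.  It is translation-invariant because translations are
    isometries of the cube ([ecc_shift]), and the condition at the origin is the
    definition of [Cen], because moving [u] to the origin turns distances to [u]
    into norms, so that [pnorm (shift pi u) = ecc u pi] ([pnorm_shift]). *)

Lemma xorK n (v : cube n) : involutive (fun u => xor u v).
Proof. by move=> u; apply/ffunP => i; rewrite !ffunE addbK. Qed.

Lemma xorv n (u : cube n) : xor u u = zero n.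
Proof. by apply/ffunP => i; rewrite !ffunE addbb. Qed.

Lemma shiftK n (u : cube n) : involutive (fun pi : profile n => shift pi u).
Proof.
case=> k t; congr Tagged; apply: val_inj.
by rewrite /= -map_comp map_id_in // => x _; apply: xorK.
Qed.

Lemma dist_xor n (u v w : cube n) : dist (xor u w) (xor v w) = dist u v.
Proof.
apply: eq_bigr => i _; rewrite !ffunE.
by case: (u i) (v i) (w i) => [] [] [].
Qed.

Lemma ecc_shift n (pi : profile n) (u v : cube n) :
  ecc (xor u v) (shift pi v) = ecc u pi.
Proof.
by rewrite /ecc big_map; apply: eq_bigr => x _; rewrite dist_xor.
Qed.

Lemma pnorm_shift n (pi : profile n) (u : cube n) :
  pnorm (shift pi u) = ecc u pi.
Proof. by rewrite -(ecc_shift n pi u u) xorv. Qed.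

Lemma translation_Cen n : translation (@Cen n).
Proof.
move=> pi u v; rewrite !inE => /forallP umin; apply/forallP => y.
by rewrite ecc_shift -(xorK n v y) ecc_shift umin.
Qed.

Lemma zero_Cen n (pi : profile n) :
  zero n \in Cen pi <-> (forall u, pnorm pi <= pnorm (shift pi u)).
Proof.
rewrite inE; split=> [/forallP min0 u | min0].
  by rewrite pnorm_shift; apply: min0.
by apply/forallP => u; move: (min0 u); rewrite pnorm_shift.
Qed.

(** [translation] is only an implication; applying it a second time, with the same [u],
    undoes the shift and gives the converse. *)
Lemma translation_mem n (f : profile n -> {set cube n}) (pi : profile n)
    (u : cube n) :
  translation f -> (u \in f pi) = (zero n \in f (shift pi u)).
Proof.
move=> fT; rewrite -(xorv n u); apply/idP/idP => [|uu_in]; first exact: fT.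
by have := fT _ _ u uu_in; rewrite (xorK n u u) (shiftK n u pi).
Qed.

Theorem corollary1 (n : nat) (f : profile n -> {set cube n}) (hf : consensus f) :
  f =1 @Cen n <->
  translation f /\
  (forall pi : profile n,
     zero n \in f pi <->
     (forall u : cube n, pnorm pi <= pnorm (shift pi u))).
Proof.
split=> [fCen | [fT f0] pi].
  split=> [pi u v | pi]; rewrite !fCen; first exact: translation_Cen.
  exact: zero_Cen.
apply/setP => u.
rewrite (translation_mem _ _ _ _ fT).
rewrite (translation_mem _ _ _ _ (translation_Cen n)).
by apply/idP/idP => [/f0/zero_Cen | /zero_Cen/f0].
Qed.
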